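(* Let $X$ be a complex Hilbert space and let $$H=\begin{pmatrix} A & B\\ C & -A^*\end{pmatrix}$$ be a Hamiltonian operator matrix on $X\times X$. Suppose that $\mathcal{D}(H)=\mathcal{D}(A)\times\mathcal{D}(A^* )$ and that $A$ or $-A$ is maximal accretive. Then $JH=(JH)^*$ if one of the following holds: (1) $C$ is $A$-bounded with relative bound $<1$ and $B$ is $A^*$-bounded with relative bound $\leq 1$; (2) $C$ is $A$-bounded with relative bound $\leq 1$ and $B$ is $A^*$-bounded with relative bound $<1$.
   Context: All operators are linear and possibly unbounded; $\mathcal{D}(T)$ denotes the domain of $T$. Block operator matrix: for operators $A,B,C,D$ in $X$, the matrix $H=\begin{pmatrix} A&B\\ C&D\end{pmatrix}$ denotes the operator on $X\times X$ with domain $\mathcal{D}(H)=(\mathcal{D}(A)\cap\mathcal{D}(C))\times(\mathcal{D}(B)\cap\mathcal{D}(D))$ and action $H(x_1,x_2)^t=(Ax_1+Bx_2,\;Cx_1+Dx_2)^t$. Hamiltonian operator matrix: a block operator matrix $H=\begin{pmatrix} A&B\\ C&-A^*\end{pmatrix}$ on $X\times X$, $X$ a complex Hilbert space, where $A,B,C$ are closed densely defined operators in $X$, $B$ and $C$ are self-adjoint, and $H$ is densely defined. $J=\begin{pmatrix}0&I\\-I&0\end{pmatrix}$ on $X\times X$. Relative boundedness: $S$ is $T$-bounded if $\mathcal{D}(T)\subset\mathcal{D}(S)$ and there are $a,b\ge 0$ with $\|Sx\|\le a\|Tx\|+b\|x\|$ for all $x\in\mathcal{D}(T)$; the relative bound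 is the infimum of all such $a$. An operator $T$ in $X$ is accretive if $\mathrm{Re}(Tx,x)\ge 0$ for all $x\in\mathcal{D}(T)$, and maximal accretive if it is accretive and has no proper accretive extension. *)

(* Defs.v *)
From HB Require Import structures.
From mathcomp Require Import all_boot all_order all_algebra sesquilinear complex.
From mathcomp Require Import all_classical all_reals all_analysis.

Set Implicit Arguments.
Unset Strict Implicit.
Unset Printing Implicit Defensive.

Import Order.TTheory GRing.Theory Num.Theory numFieldNormedType.Exports.

Local Open Scope classical_set_scope.
Local Open Scope ring_scope.
Local Open Scope complex_scope.

(* The values of [app] outside [dom] are junk: operators are compared with
   [op_eq] or [op_ext], never with Leibniz equality. Linearity is the separate
   predicate [linear_op]. *)
Record operator (U V : Type) := Operator { dom : set U; app :> U -> V }.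

Section Operators.
Context {K : numFieldType} {U V W : lmodType K}.

Definition linear_op (T : operator U V) : Prop :=
  dom T 0 /\
  forall (a : K) (x y : U), dom T x -> dom T y ->
    dom T (a *: x + y) /\ T (a *: x + y) = a *: T x + T y.

Definition op_ext (S T : operator U V) : Prop :=
  dom S `<=` dom T /\ forall x, dom S x -> T x = S x.

Definition op_eq (S T : operator U V) : Prop :=
  dom S = dom T /\ forall x, dom S x -> S x = T x.

Definition op_zero : operator U V := Operator setT (fun=> 0).

Definition op_id : operator U U := Operator setT id.

Definition op_opp (T : operator U V) : operator U V :=
  Operator (dom T) (fun x => - T x).

Definition op_comp (S : operator V W) (T : operator U V) : operator U W :=
  Operator [set x | dom T x /\ dom S (T x)] (fun x => S (T x)).

End Operators.

Section Endomorphisms.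
Context {K : numFieldType} {U : lmodType K}.

Definition block_op (A B C D : operator U U) : operator (U * U)%type (U * U)%type :=
  Operator ((dom A `&` dom C) `*` (dom B `&` dom D))
           (fun x => (A x.1 + B x.2, C x.1 + D x.2)).

(* [<T x, y> = <x, z>] for all [x] in [dom T] determines [z] when [dom T] is
   dense; only then is the value of the adjoint meaningful. *)
Definition adjoint (f : U -> U -> K) (T : operator U U) : operator U U :=
  let is_adj y := [set z | forall x, dom T x -> f (T x) y = f x z] in
  Operator [set y | is_adj y !=set0] (fun y => xget 0 (is_adj y)).

Definition selfadjoint (f : U -> U -> K) (T : operator U U) : Prop :=
  op_eq T (adjoint f T).

(* The inner product of the Hilbert space direct sum. The library norm on
   [U * U] is the equivalent max norm, which induces the same topology. *)
Definition dot_prod (f : U -> U -> K) (u v : U * U) : K :=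
  f u.1 v.1 + f u.2 v.2.

Definition op_J : operator (U * U)%type (U * U)%type :=
  block_op op_zero op_id (op_opp op_id) op_zero.

End Endomorphisms.

Section HilbertOperators.
Context {R : realType} {X : completeNormedModType R[i]}.
Implicit Types (f : X -> X -> R[i]) (A B C S T : operator X X).

Definition closed_op T : Prop :=
  closed [set p : X * X | dom T p.1 /\ p.2 = T p.1].

Definition closed_densely_defined T : Prop :=
  [/\ linear_op T, closed_op T & dense (dom T)].

Definition accretive f T : Prop :=
  forall x, dom T x -> 0 <= complex.Re (f (T x) x).

Definition maximal_accretive f T : Prop :=
  accretive f T /\
  forall S, linear_op S -> accretive f S -> op_ext T S -> op_eq S T.

(* The norm of [X] takes its values in [R[i]], hence the injections [%:C]. *)
Definition rel_bound_with S T (a b : R) : Prop :=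
  [/\ 0 <= a, 0 <= b &
      forall x, dom T x -> `|S x| <= a%:C * `|T x| + b%:C * `|x|].

Definition rel_bounded S T : Prop :=
  dom T `<=` dom S /\ exists a b, rel_bound_with S T a b.

Definition rel_bound S T : R := inf [set a | exists b, rel_bound_with S T a b].

Definition hamiltonian_op f A B C : operator (X * X)%type (X * X)%type :=
  block_op A B C (op_opp (adjoint f A)).

Definition is_hamiltonian f A B C : Prop :=
  [/\ closed_densely_defined A, closed_densely_defined B,
      closed_densely_defined C, selfadjoint f B /\ selfadjoint f C
    & dense (dom (hamiltonian_op f A B C))].

End HilbertOperators.

(* Main.v *)
Require Import Defs.
From HB Require Import structures.
From mathcomp Require Import all_boot all_order all_algebra sesquilinear complex.
From mathcomp Require Import all_classical all_reals all_analysis.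
From mathcomp Require Import ring lra.

Set Implicit Arguments.
Unset Strict Implicit.
Unset Printing Implicit Defensive.

Import Order.TTheory GRing.Theory Num.Theory numFieldNormedType.Exports.

Local Open Scope classical_set_scope.
Local Open Scope ring_scope.

(** [J H] maps [(x, y)] to [(C x - A^* y, - A x - B y)], for [x] in the domain of
    [A] and [y] in that of [A^*], and is symmetric. A symmetric operator [W] is
    self-adjoint as soon as [W + N] is onto for some bounded symmetric [N]
    ([selfadjoint_of_surjective]). The proof takes [N (x, y) = (t y, t x)] with
    [t] real, which amounts to replacing [A] by [A - t].

    Let [T] be the maximal accretive one of [A] and [- A], let [S = T^*] and
    [l > 0]. Up to signs, surjectivity of [W + N] is solvability of
      [C x + (S + l) y = f],   [(T + l) x - B y = g].
    Both [T + l] and [S + l] are bijective. For [T + l] this is Phillips' theorem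
    ([maximal_accretive_shift_surjective]): a vector orthogonal to the range
    could be used to extend [T]. For [S + l] it is the Riesz representation
    theorem applied to [u |-> <(T + l)^-1 u, v>] ([adjoint_shift_surjective]).
    Eliminating [x] and [v = (S + l) y] leaves one equation on the whole space,
      [v + C (T + l)^-1 B (S + l)^-1 v = f - C (T + l)^-1 g].

    Accretivity gives [|T x| <= |(T + l) x|] and [l |x| <= |(T + l) x|], and the
    same for [S]. If [|C x| <= a |T x| + b |x|] and [|B y| <= a' |S y| + b' |y|],
    then [C (T + l)^-1] and [B (S + l)^-1] have norms at most [a + b / l] and
    [a' + b' / l]. Since one relative bound is below 1 and the other at most 1,
    the constants can be chosen with [a a' < 1]; for [l] large the composite is
    then a strict contraction and the equation is solvable. Only the product of
    the relative bounds enters, which is why one of them may be equal to 1.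

    The Hilbert space facts used on the way (projection onto a closed subspace,
    Riesz representation, closed range of a closed operator bounded below) are
    derived from completeness. *)

Local Open Scope complex_scope.

(** * Real-valued norm and completeness *)

Section RealNorm.
Context {R : realType} {V : normedModType R[i]}.
Implicit Types x y : V.

(** The norm has values in [R[i]]; its real part is used so that estimates take
    place in the totally ordered field [R]. *)
Definition nrm x : R := complex.Re `|x|.

Lemma nrmE x : `|x| = (nrm x)%:C.
Proof. by rewrite /nrm RRe_real // ger0_real. Qed.

Lemma nrm_ge0 x : 0 <= nrm x.
Proof. by rewrite -ler0c -nrmE. Qed.

Lemma nrm_eq0 x : nrm x = 0 -> x = 0.
Proof. by move=> x0; apply/normr0_eq0; rewrite nrmE x0. Qed.

Lemma nrm0 : nrm (0 : V) = 0.
Proof. by rewrite /nrm normr0. Qed.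

Lemma nrmN x : nrm (- x) = nrm x.
Proof. by rewrite /nrm normrN. Qed.

Lemma nrmC x y : nrm (x - y) = nrm (y - x).
Proof. by rewrite /nrm distrC. Qed.

Lemma ler_nrmD x y : nrm (x + y) <= nrm x + nrm y.
Proof. by rewrite -lecR rmorphD /= -!nrmE ler_normD. Qed.

Lemma nrmZ (a : R[i]) x : nrm (a *: x) = complex.Re `|a| * nrm x.
Proof.
by apply/complexI; rewrite -nrmE normrZ rmorphM /= -nrmE.
Qed.

Lemma nrmZr (a : R) x : 0 <= a -> nrm (a%:C *: x) = a * nrm x.
Proof. by move=> a0; rewrite nrmZ ger0_norm // ler0c. Qed.

Lemma ball_nrmE x y (e : R) : ball x e%:C y <-> nrm (x - y) < e.
Proof. by rewrite -ball_normE /ball_ /= nrmE ltcR. Qed.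

Lemma gtr0_complex_real (e : R[i]) : 0 < e -> exists2 e' : R, 0 < e' & e = e'%:C.
Proof.
move=> e0; exists (complex.Re e); last by rewrite RRe_real // gtr0_real.
by rewrite -ltcR RRe_real // gtr0_real.
Qed.

Lemma closed_nrmP (E : set V) :
  closed E <->
  forall x, (forall e, 0 < e -> exists2 y, E y & nrm (x - y) < e) -> E x.
Proof.
split=> [clE x xE|clE x xE].
  apply: clE => B /nbhs_ballP [e /= /gtr0_complex_real [e' e0 ->] eB].
  by have [y Ey xy] := xE _ e0; exists y; split => //; apply: eB; apply/ball_nrmE.
apply: clE => e e0.
have [|y [Ey /ball_nrmE xy]] := xE (ball x e%:C); last by exists y.
by apply: nbhsx_ballx; rewrite ltcR.
Qed.

Lemma dense_nrm (E : set V) x (e : R) :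
  dense E -> 0 < e -> exists2 y, E y & nrm (x - y) < e.
Proof.
move=> dE e0; have e0' : 0 < e%:C by rewrite ltcR.
have [||y [xy Ey]] := dE (interior (ball x e%:C)).
- by exists x; apply: nbhsx_ballx.
- exact: open_interior.
by exists y => //; apply/ball_nrmE; apply: interior_subset xy.
Qed.

End RealNorm.

(** The norm of the product is the max norm, so closeness of pairs, hence of
    points of a graph, is checked on each component. *)
Lemma nrm_pair {R : realType} {V W : normedModType R[i]} (p : V * W) e :
  (nrm p < e) = (nrm p.1 < e) && (nrm p.2 < e).
Proof.
rewrite -ltcR -nrmE prod_normE comparable_gt_max; last exact: real_comparable.
by rewrite !nrmE !ltcR.
Qed.

Section Completeness.
Context {R : realType} {X : completeNormedModType R[i]}.

(** Cantor's intersection theorem: the sets [P d] decrease with [d] and their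
    diameters tend to 0, so they generate a Cauchy filter. *)
Lemma nested_limit (P : R -> X -> Prop) :
  (forall d, 0 < d -> exists x, P d x) ->
  (forall d d' x, d <= d' -> P d x -> P d' x) ->
  (forall e, 0 < e -> exists2 d, 0 < d &
     forall x y, P d x -> P d y -> nrm (x - y) < e) ->
  exists l, forall d, 0 < d -> exists2 x, P d x & nrm (l - x) < d.
Proof.
move=> P0 Pmono Psmall; pose F := filter_from [set d : R | 0 < d] P.
have FF : ProperFilter F.
  apply: filter_from_proper; last by move=> d /P0.
  apply: filter_from_filter; first by exists 1 => /=.
  move=> d d' /= d0 d'0; exists (Num.min d d'); first by rewrite /= lt_min d0.
  by move=> x Px; split; apply: Pmono Px; rewrite ge_min lexx ?orbT.
have Fl : cvg F.
  apply: cauchy_cvg; apply: cauchy_exP => _ /gtr0_complex_real [e e0 ->].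
  have [d d0 dP] := Psmall _ e0; have [x Px] := P0 _ d0; exists x.
  by exists d => // y Py; apply/ball_nrmE; apply: dP.
exists (lim F) => d d0.
have d0' : 0 < d%:C by rewrite ltcR.
have [d' /= d'0 d'P] : F (ball (lim F) d%:C) by apply: Fl; apply: nbhsx_ballx.
have m0 : 0 < Num.min d d' by rewrite lt_min d0.
have [x Px] := P0 _ m0; exists x; first by apply: Pmono Px; rewrite ge_min lexx.
by apply/ball_nrmE/d'P; apply: Pmono Px; rewrite ge_min lexx orbT.
Qed.

End Completeness.

(** * Inner product, projection and Riesz representation *)

Section InnerProduct.
Context {R : realType} {X : completeNormedModType R[i]}.
Variable dot : {dot X for Num.conj}.
Hypothesis norm_dot : forall x : X, `|x| ^+ 2 = dot x x.
Implicit Types x y z : X.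

Definition rdot x y : R := complex.Re (dot x y).

Lemma dotC x y : dot x y = Num.conj (dot y x).
Proof. by rewrite hermC expr0 mul1r. Qed.

Lemma dotxx x : dot x x = (nrm x ^+ 2)%:C.
Proof. by rewrite -norm_dot nrmE rmorphXn. Qed.

Lemma rdotC x y : rdot x y = rdot y x.
Proof. by rewrite /rdot dotC; case: (dot y x). Qed.

Lemma rdotxx x : rdot x x = nrm x ^+ 2.
Proof. by rewrite /rdot dotxx. Qed.

Lemma rdotDl x y z : rdot (x + y) z = rdot x z + rdot y z.
Proof. by rewrite /rdot linearDl raddfD. Qed.

Lemma rdotDr x y z : rdot x (y + z) = rdot x y + rdot x z.
Proof. by rewrite rdotC rdotDl !(rdotC x). Qed.

Lemma rdotNl x z : rdot (- x) z = - rdot x z.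
Proof. by rewrite /rdot linearNl raddfN. Qed.

Lemma rdotNr x z : rdot x (- z) = - rdot x z.
Proof. by rewrite rdotC rdotNl rdotC. Qed.

Lemma rdotZl (a : R) x z : rdot (a%:C *: x) z = a * rdot x z.
Proof. by rewrite /rdot linearZl_LR /=; case: (dot x z) => u v /=; ring. Qed.

Lemma rdotZr (a : R) x z : rdot x (a%:C *: z) = a * rdot x z.
Proof. by rewrite rdotC rdotZl rdotC. Qed.

Lemma nrmD_sqr x y : nrm (x + y) ^+ 2 = nrm x ^+ 2 + 2 * rdot x y + nrm y ^+ 2.
Proof. rewrite -!rdotxx rdotDl !rdotDr (rdotC y x); ring. Qed.

Lemma nrmB_sqr x y : nrm (x - y) ^+ 2 = nrm x ^+ 2 - 2 * rdot x y + nrm y ^+ 2.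
Proof. by rewrite nrmD_sqr rdotNr nrmN mulrN. Qed.

(** The real part of the Cauchy-Schwarz inequality is the square of the triangle
    inequality for the norm. *)
Lemma rdot_le x y : rdot x y <= nrm x * nrm y.
Proof.
have := ler_nrmD x y; rewrite -(ler_pXn2r (n:=2)) // ?nnegrE ?addr_ge0 ?nrm_ge0 //.
rewrite nrmD_sqr; lra.
Qed.

Lemma parallelogram x y :
  nrm (x + y) ^+ 2 + nrm (x - y) ^+ 2 = 2 * nrm x ^+ 2 + 2 * nrm y ^+ 2.
Proof. by rewrite nrmD_sqr nrmB_sqr; ring. Qed.

Lemma dot_eq0_sym x y : dot x y = 0 -> dot y x = 0.
Proof. by move=> xy; rewrite dotC xy rmorph0. Qed.

(** Otherwise some [x] in [D] is closer to [w = z - z'] than [0] is, while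
    [x] is orthogonal to [w]. *)
Lemma dense_dot_inj (D : set X) z z' :
  dense D -> (forall x, D x -> dot x z = dot x z') -> z = z'.
Proof.
move=> dD zz'; set w := z - z'; apply/eqP; rewrite -subr_eq0 -/w; apply/eqP.
apply: contrapT => w0.
have nw : 0 < nrm w.
  by rewrite lt_def nrm_ge0 andbT; apply/eqP => /nrm_eq0.
have [x Dx wx] := dense_nrm w dD nw.
have xw : rdot x w = 0 by rewrite /rdot /w linearBr /= zz' // subrr.
have := rdot_le (w - x) w.
rewrite rdotDl rdotNl xw subr0 rdotxx; nra.
Qed.

Definition vector_subspace (M : set X) :=
  M 0 /\ forall (a : R[i]) x y, M x -> M y -> M (a *: x + y).

(** Near-minimizers of the distance to [x] are close to each other by the
    parallelogram identity, because their midpoint is in [M]. *)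
Lemma minimizer_exists (M : set X) x :
  vector_subspace M -> closed M ->
  exists2 m, M m & forall k, M k -> nrm (x - m) <= nrm (x - k).
Proof.
move=> [M0 Mlin] /closed_nrmP clM.
pose S := [set nrm (x - k) | k in M].
have Slb : has_inf S.
  split; first by exists (nrm (x - 0)); exists 0.
  by exists 0 => _ [k _ <-]; exact: nrm_ge0.
set d := inf S.
have dle k : M k -> d <= nrm (x - k).
  by move=> Mk; apply: ge_inf; [case: Slb | exists k].
have d0 : 0 <= d by apply: lb_le_inf; [case: Slb | move=> _ [k _ <-]; exact: nrm_ge0].
have [e||e e0|m mP] := @nested_limit R X (fun e k => M k /\ nrm (x - k) < d + e).
- by move=> e0; have [_ [k Mk <-] ke] := inf_adherent e0 Slb; exists k.
- by move=> e e' k ee' [Mk ke]; split=> //; apply: lt_le_trans ke _; rewrite lerD2l.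
- pose s := Num.min 1 (e ^+ 2 / (8 * d + 4)).
  have s0 : 0 < s by rewrite lt_min ltr01 divr_gt0 ?exprn_gt0 //; lra.
  have s1 : s <= 1 by rewrite ge_min lexx.
  have se : s * (8 * d + 4) <= e ^+ 2.
    by rewrite -ler_pdivlMr; [rewrite ge_min lexx orbT | lra].
  exists s => // k k' [Mk kd] [Mk' k'd].
  (* the midpoint of [k] and [k'] lies in [M], at distance at least [d] from [x] *)
  have Mmid : M ((2^-1 : R)%:C *: (k + k')).
    have Mkk' : M (k + k') by rewrite -[k]scale1r; apply: Mlin.
    by rewrite -[_ *: _]addr0; apply: Mlin.
  have := dle _ Mmid; have := parallelogram (x - k) (x - k').
  have -> : (x - k) + (x - k') = 2%:C *: (x - (2^-1 : R)%:C *: (k + k')).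
    rewrite scalerBr scalerA -rmorphM /= divff // scale1r.
    by rewrite rmorphMn /= rmorph1 scaler_nat mulr2n opprD addrACA.
  have -> : x - k - (x - k') = k' - k by rewrite opprB addrC subrKA.
  rewrite nrmZr // (nrmC k' k).
  have k2 : nrm (x - k) ^+ 2 < (d + s) ^+ 2.
    by rewrite ltr_pXn2r // ?nnegrE ?nrm_ge0 // addr_ge0 // ltW.
  have k'2 : nrm (x - k') ^+ 2 < (d + s) ^+ 2.
    by rewrite ltr_pXn2r // ?nnegrE ?nrm_ge0 // addr_ge0 // ltW.
  move=> eqn dmid; have mid2 : d ^+ 2 <= nrm (x - (2^-1 : R)%:C *: (k + k')) ^+ 2.
    by rewrite ler_pXn2r // ?nnegrE ?nrm_ge0.
  rewrite -(ltr_pXn2r (n := 2)) // ?nnegrE ?nrm_ge0 //; last exact: ltW.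
  have ss : s ^+ 2 <= s by rewrite expr2 ler_piMl // ltW.
  by move: eqn k2 k'2 mid2 ss se; lra.
exists m.
  by apply: clM => e /mP [k [Mk _]]; exists k.
move=> k Mk; apply: le_trans (dle _ Mk); apply/ler_addgt0Pr => e e0.
have e20 : 0 < e / 2 by lra.
have [k' [Mk' k'd] mk'] := mP _ e20.
have := ler_nrmD (x - k') (k' - m); rewrite subrKA (nrmC k' m); lra.
Qed.

(** Minimality of [m] along the real line [m + t k] kills the real part of
    [dot (x - m) k]; the line through ['i *: k] kills the imaginary part. *)
Lemma projection (M : set X) x :
  vector_subspace M -> closed M ->
  exists2 m, M m & forall k, M k -> dot (x - m) k = 0.
Proof.
move=> linM clM; have [m Mm mmin] := minimizer_exists x linM clM.
case: linM => [M0 Mlin]; exists m => //.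
have re0 k : M k -> rdot (x - m) k = 0.
  move=> Mk; set w := x - m; set r := rdot w k; set q := nrm k ^+ 2.
  have q0 : 0 <= q by rewrite exprn_ge0 // nrm_ge0.
  (* the exact minimum is at [r / q]; adding 1 avoids the case [k = 0] *)
  set t := r / (q + 1).
  have rt : r = t * (q + 1) by rewrite divfK //; lra.
  have Mt : M (t%:C *: k + m) by apply: Mlin.
  have := mmin _ Mt.
  rewrite -(ler_pXn2r (n := 2)) // ?nnegrE ?nrm_ge0 //.
  have -> : x - (t%:C *: k + m) = w - t%:C *: k by rewrite /w opprD addrAC addrA.
  rewrite [nrm (w - _) ^+ 2]nrmB_sqr rdotZr -/r.
  have -> : nrm (t%:C *: k) ^+ 2 = t ^+ 2 * q.
    by rewrite -rdotxx rdotZl rdotZr rdotxx mulrA.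
  rewrite rt -/w => le.
  have t2 : t ^+ 2 * (q + 2) <= 0 by move: le; lra.
  have t0 : t = 0.
    apply/eqP; rewrite -sqrf_eq0 eq_le sqr_ge0 andbT.
    by move: t2; rewrite pmulr_lle0 //; lra.
  by rewrite t0 mul0r.
move=> k Mk; have rek := re0 _ Mk.
have Mik : M ('i *: k) by rewrite -[_ *: _]addr0; apply: Mlin.
have := re0 _ Mik; move: rek; rewrite /rdot linearZr_LR /=.
by case: (dot _ _) => u v /=; simpc => /= -> ->.
Qed.

(** The representing vector is a multiple of a vector orthogonal to the kernel.
    Boundedness enters through the real part only, which suffices because [phi]
    can be evaluated at the multiples of [x] by 1, -1, ['i] and [- 'i]. *)
Lemma riesz (phi : X -> R[i]) (c : R) :
  (forall (a : R[i]) x y, phi (a *: x + y) = a * phi x + phi y) ->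
  0 <= c -> (forall x, complex.Re (phi x) <= c * nrm x) ->
  exists w, forall x, phi x = dot x w.
Proof.
move=> phil c0 phic; pose M := [set x | phi x = 0].
have phi0 : phi 0 = 0.
  by have := phil (-1) 0 0; rewrite scaler0 addr0 mulN1r addNr.
have phiZ a x : phi (a *: x) = a * phi x by rewrite -[_ *: _]addr0 phil phi0 addr0.
have phiB x y : phi (x - y) = phi x - phi y.
  have -> : x - y = -1 *: y + x by rewrite scaleN1r addrC.
  by rewrite phil mulN1r addrC.
have linM : vector_subspace M.
  by split=> // a x y; rewrite /M /= => x0 y0; rewrite phil x0 y0 mulr0 addr0.
have clM : closed M.
  apply/closed_nrmP => x xM; rewrite /M /=.
  have re0 (a : R[i]) : complex.Re (phi (a *: x)) <= 0.
    apply/ler_addgt0Pr => e e0; rewrite add0r.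
    have n0 : 0 <= complex.Re `|a| by rewrite -ler0c RRe_real // ger0_real.
    have d0 : 0 < e / (c * complex.Re `|a| + 1).
      by rewrite divr_gt0 // ltr_wpDl // mulr_ge0.
    have [y /= y0 xy] := xM _ d0.
    have := phic (a *: (x - y)).
    rewrite phiZ phiB y0 subr0 -phiZ nrmZ.
    move/le_trans; apply; rewrite mulrA.
    apply: (@le_trans _ _ (c * complex.Re `|a| * (e / (c * complex.Re `|a| + 1)))).
      by rewrite ler_wpM2l ?mulr_ge0 // ltW.
    rewrite mulrA ler_pdivrMr ?ltr_wpDl ?mulr_ge0 //.
    by rewrite mulrC ler_pM2l // lerDl.
  have := re0 1; have := re0 (-1); have := re0 'i; have := re0 (-'i).
  rewrite !phiZ; case: (phi x) => u v; simpc => /= h1 h2 h3 h4.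
  by apply/eqP; rewrite eq_complex /=; apply/andP; split; apply/eqP; lra.
have [all0|] := pselect (forall x, phi x = 0).
  by exists 0 => x; rewrite all0 linear0r.
move=> /existsNP [x0 x0n0].
have [m /= m0 mP] := projection x0 linM clM.
set h := x0 - m in mP.
have hx0 : phi h = phi x0 by rewrite phiB m0 subr0.
have h0 : dot h h != 0.
  rewrite dotxx eq_complex /= eqxx andbT sqrf_eq0; apply/eqP => /nrm_eq0 hh.
  by apply: x0n0; rewrite -hx0 hh.
exists (Num.conj (phi h / dot h h) *: h) => x.
rewrite linearZr_LR /= conjCK.
have : phi (x - (phi x / phi h) *: h) = 0.
  by rewrite phiB phiZ divfK ?subrr // hx0; apply/eqP.
move=> /(mP _) /dot_eq0_sym; rewrite linearBl /= linearZl_LR /= => /eqP.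
rewrite subr_eq0 => /eqP ->.
have hn0 : phi h != 0 by rewrite hx0; apply/eqP.
by field; rewrite h0 hn0.
Qed.

End InnerProduct.

(** * Closed operators bounded below *)

Section LinearOperators.
Context {R : realType} {X : completeNormedModType R[i]}.
Implicit Types S T : operator X X.

Lemma linear_op0 T : linear_op T -> T 0 = 0.
Proof.
move=> [d0 Tl]; have [_] := Tl (-1) 0 0 d0 d0.
by rewrite scaler0 add0r => ->; rewrite scaleN1r addNr.
Qed.

Lemma linear_opZ T (a : R[i]) x :
  linear_op T -> dom T x -> dom T (a *: x) /\ T (a *: x) = a *: T x.
Proof.
move=> Tl dx; have [d0 Tl'] := Tl; have := Tl' a x 0 dx d0.
by rewrite !addr0 linear_op0 // addr0.
Qed.

Lemma linear_opN T x : linear_op T -> dom T x -> dom T (- x) /\ T (- x) = - T x.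
Proof. by move=> Tl dx; rewrite -scaleN1r -[- T x]scaleN1r; exact: linear_opZ. Qed.

Lemma linear_opB T x y : linear_op T -> dom T x -> dom T y ->
  dom T (x - y) /\ T (x - y) = T x - T y.
Proof.
move=> [d0 Tl] dx dy; have := Tl (-1) y x dy dx.
by rewrite !scaleN1r ![- _ + _]addrC.
Qed.

Lemma closed_op_opp T : closed_op T -> closed_op (op_opp T).
Proof.
move=> /closed_nrmP clT; apply/closed_nrmP => -[x y] /= xyT.
suff [] : dom T x /\ - y = T x by move=> dx <-; rewrite opprK.
apply: (clT (x, - y)) => e e0; have [[x' y'] /= [dx' ->]] := xyT e e0.
rewrite nrm_pair /= => /andP[xx' yy']; exists (x', T x') => //.
by rewrite nrm_pair /= xx' -opprD nrmN -[T x']opprK.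
Qed.

Lemma linear_op_opp T : linear_op T -> linear_op (op_opp T).
Proof.
move=> [d0 Tl]; split=> // a x y dx dy; have [dxy /= ->] := Tl a x y dx dy.
by split=> //; rewrite opprD scalerN.
Qed.

Definition op_shift T (l : R) : operator X X :=
  Operator (dom T) (fun x => T x + l%:C *: x).

Lemma linear_op_shift T l : linear_op T -> linear_op (op_shift T l).
Proof.
move=> [d0 Tl]; split=> // a x y /= dx dy; have [daxy ->] := Tl a x y dx dy.
by split=> //; rewrite !scalerDr !scalerA [l%:C * a]mulrC addrACA.
Qed.

Lemma closed_op_shift T l : 0 <= l -> closed_op T -> closed_op (op_shift T l).
Proof.
move=> l0 /closed_nrmP clT; apply/closed_nrmP => -[x y] /= xyT.
suff [] : dom T x /\ y - l%:C *: x = T x.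
  by move=> dx <-; split=> //; rewrite subrK.
apply: (clT (x, y - l%:C *: x)) => e e0.
have d0 : 0 < e / (l + 1) by apply: divr_gt0 => //; lra.
have [[x' y'] /= [dx' ->]] := xyT _ d0.
rewrite nrm_pair /= => /andP[xx' yy']; exists (x', T x') => //.
have de : e / (l + 1) * (l + 1) = e by rewrite divfK //; lra.
have dle : 0 <= e / (l + 1) * l by rewrite mulr_ge0 // ltW.
rewrite nrm_pair /=; apply/andP; split.
  by apply: lt_le_trans xx' _; move: de dle; lra.
have -> : y - l%:C *: x - T x' = (y - (T x' + l%:C *: x')) + l%:C *: (x' - x).
  by rewrite scalerBr opprD !addrA subrK addrAC.
apply: le_lt_trans (ler_nrmD _ _) _.
rewrite nrmZr // (nrmC x'); have := ler_wpM2l l0 (ltW xx'); move: de yy'; lra.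
Qed.

(** Approximate preimages of [y] are close to each other, because [T] is bounded
    below; their limit is a preimage, because the graph is closed. *)
Lemma closed_range T (c : R) :
  linear_op T -> closed_op T -> 0 < c ->
  (forall x, dom T x -> c * nrm x <= nrm (T x)) ->
  closed (T @` dom T).
Proof.
move=> Tl /closed_nrmP clT c0 Tc; apply/closed_nrmP => y yT.
have [e e0||e e0|x xP] := @nested_limit R X (fun e x => dom T x /\ nrm (y - T x) < e).
- by have [_ [x dx <-] xe] := yT _ e0; exists x.
- by move=> e e' x ee' [dx xe]; split=> //; apply: lt_le_trans xe ee'.
- exists (c * e / 2); first by rewrite divr_gt0 // mulr_gt0.
  move=> x x' [dx xe] [dx' x'e]; have [dxx' Txx'] := linear_opB Tl dx dx'.
  rewrite -(ltr_pM2l c0); apply: le_lt_trans (Tc _ dxx') _; rewrite Txx'.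
  have -> : T x - T x' = (T x - y) + (y - T x') by rewrite addrA subrK.
  by apply: le_lt_trans (ler_nrmD _ _) _; rewrite (nrmC (T x)); lra.
have [dx Tx] : dom T x /\ y = T x.
  apply: (clT (x, y)) => e e0; have [x' [dx' x'e] xx'] := xP _ e0.
  by exists (x', T x') => //; rewrite nrm_pair /= xx'.
by exists x.
Qed.

(** The inverse is a total function, so that the composites formed from it below
    are everywhere defined. *)
Lemma bounded_inverse T (c : R) :
  linear_op T -> 0 < c ->
  (forall x, dom T x -> c * nrm x <= nrm (T x)) ->
  (forall y, exists2 x, dom T x & T x = y) ->
  exists G : X -> X,
    [/\ forall y, dom T (G y) /\ T (G y) = y,
        forall x, dom T x -> G (T x) = x,
        forall (a : R[i]) x y, G (a *: x + y) = a *: G x + G y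
      & forall y, c * nrm (G y) <= nrm y].
Proof.
move=> Tl c0 Tc Tonto.
have Tinj x y : dom T x -> dom T y -> T x = T y -> x = y.
  move=> dx dy Txy; have [dxy Txy0] := linear_opB Tl dx dy.
  apply/eqP; rewrite -subr_eq0; apply/eqP/nrm_eq0/eqP.
  rewrite eq_le nrm_ge0 andbT -(pmulr_rle0 _ c0).
  by apply: le_trans (Tc _ dxy) _; rewrite Txy0 Txy subrr nrm0.
have [G GP] : {G : X -> X & forall y, dom T (G y) /\ T (G y) = y}.
  by apply: (@choice _ _ (fun y x => dom T x /\ T x = y)) => y; have [x] := Tonto y; exists x.
exists G; split=> //.
- by move=> x dx; have [dG GT] := GP (T x); exact: Tinj.
- move=> a x y; have [dx Tx] := GP x; have [dy Ty] := GP y.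
  have [dxy Txy] := (proj2 Tl) a _ _ dx dy; have [d' T'] := GP (a *: x + y).
  by apply: Tinj => //; rewrite T' Txy Tx Ty.
- by move=> y; have [dy Ty] := GP y; rewrite -{2}Ty; exact: Tc.
Qed.

End LinearOperators.

Section Surjectivity.
Context {R : realType} {X : completeNormedModType R[i]}.
Variable dot : {dot X for Num.conj}.
Hypothesis norm_dot : forall x : X, `|x| ^+ 2 = dot x x.
Implicit Types S T : operator X X.

(** The range is closed, so a proper range would have a nonzero orthogonal
    vector. *)
Lemma surjective_of_orthogonal T (c : R) :
  linear_op T -> closed_op T -> 0 < c ->
  (forall x, dom T x -> c * nrm x <= nrm (T x)) ->
  (forall z, (forall x, dom T x -> dot (T x) z = 0) -> z = 0) ->
  forall y, exists2 x, dom T x & T x = y.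
Proof.
move=> Tl clT c0 Tc orth y.
have subT : vector_subspace (T @` dom T).
  split; first by exists 0; [case: Tl | exact: linear_op0].
  move=> a _ _ [x dx <-] [x' dx' <-]; have [d <-] := (proj2 Tl) a _ _ dx dx'.
  by exists (a *: x + x').
have [_ [x dx <-] xP] := projection norm_dot y subT (closed_range Tl clT c0 Tc).
exists x => //; apply/esym/eqP; rewrite -subr_eq0; apply/eqP/orth => x' dx'.
by apply: (dot_eq0_sym (xP _ _)); exists x'.
Qed.

(** [x + K x] is bounded below by [1 - k], and [z] orthogonal to its range
    satisfies [|z|^2 = - Re <K z, z> <= k |z|^2]. *)
Lemma id_plus_contraction_surjective (K : X -> X) (k : R) :
  (forall (a : R[i]) x y, K (a *: x + y) = a *: K x + K y) ->
  0 <= k < 1 -> (forall x, nrm (K x) <= k * nrm x) ->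
  forall y, exists x, x + K x = y.
Proof.
move=> Kl /andP[k0 k1] Kk y.
pose T := Operator setT (fun x => x + K x).
have Tl : linear_op T.
  by split=> // a x x' _ _; split=> //=; rewrite Kl scalerDr addrACA.
have TB x x' : T (x - x') = T x - T x'.
  by have [] := linear_opB (x := x) (y := x') Tl I I.
have KE x : K x = T x - x by rewrite /= addrC addKr.
suff [x _ <-] : exists2 x, dom T x & T x = y by exists x.
have c0 : 0 < 1 - k by lra.
apply: (@surjective_of_orthogonal T (1 - k)) => //.
- apply/closed_nrmP => -[x z] /= xz; split=> //.
  apply/eqP; rewrite -subr_eq0; apply/eqP/nrm_eq0/eqP.
  rewrite eq_le nrm_ge0 andbT; apply/ler_addgt0Pr => e e0; rewrite add0r.
  have d0 : 0 < e / 3 by lra.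
  have [[x' z'] /= [_ ->]] := xz _ d0.
  rewrite nrm_pair /= => /andP[xx' zz'].
  have -> : z - (x + K x) = (z - (x' + K x')) + T (x' - x).
    by rewrite TB /= addrA subrK.
  apply: le_trans (ler_nrmD _ _) _.
  have := ler_nrmD (x' - x) (K (x' - x)); have := Kk (x' - x).
  have : k * nrm (x' - x) <= nrm (x' - x) by rewrite ler_piMl ?nrm_ge0 // ltW.
  by rewrite (nrmC x') /=; lra.
- move=> x _ /=; have := ler_nrmD (x + K x) (- K x).
  by rewrite addrK nrmN; have := Kk x; lra.
- move=> z zT; apply: nrm_eq0; have := zT z I.
  move=> /(congr1 (@complex.Re R)) /=.
  rewrite -/(rdot dot _ _) rdotDl (rdotxx norm_dot) => zz.
  have := rdot_le norm_dot (- K z) z; rewrite rdotNl nrmN => Kz.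
  have := ler_wpM2r (nrm_ge0 z) (Kk z) => kz.
  apply/eqP; rewrite -sqrf_eq0 eq_le sqr_ge0 andbT -(pmulr_rle0 _ c0).
  by move: zz Kz kz; lra.
Qed.

End Surjectivity.

(** * Adjoints and accretive operators *)

Section AdjointPairs.
Context {R : realType} {X : completeNormedModType R[i]}.
Variable dot : {dot X for Num.conj}.
Hypothesis norm_dot : forall x : X, `|x| ^+ 2 = dot x x.
Implicit Types S T : operator X X.

(** [S] is the adjoint of [T], as a relation: unlike equality with
    [adjoint dot T], it does not see junk values and passes to opposites. *)
Definition adjoint_pair T S : Prop :=
  (forall x y, dom T x -> dom S y -> dot (T x) y = dot x (S y)) /\
  (forall y z, (forall x, dom T x -> dot (T x) y = dot x z) ->
     dom S y /\ S y = z).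

Lemma adjointP T y :
  dom (adjoint dot T) y ->
  forall x, dom T x -> dot (T x) y = dot x (adjoint dot T y).
Proof. by move=> /= -[z zP]; exact: (xgetPex 0 (ex_intro _ z zP)). Qed.

Lemma adjoint_pair_adjoint T : dense (dom T) -> adjoint_pair T (adjoint dot T).
Proof.
move=> dT; split=> [x y dx dy|y z yz]; first exact: adjointP.
have dy : dom (adjoint dot T) y by exists z.
split=> //; apply: (dense_dot_inj norm_dot dT) => x dx.
by rewrite -adjointP // yz.
Qed.

Lemma adjoint_pair_opp T S : adjoint_pair T S -> adjoint_pair (op_opp T) (op_opp S).
Proof.
move=> [TS Smax]; split=> [x y dx dy /=|y z yz /=].
  by rewrite linearNl linearNr /= TS.
have [|dy ->] := Smax y (- z); last by rewrite opprK.
by move=> x dx; rewrite linearNr /= -yz // linearNl opprK.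
Qed.

Lemma adjoint_pair_linear T S : adjoint_pair T S -> linear_op S.
Proof.
move=> [TS Smax]; split.
  by have [|] := Smax 0 0 => // x _; rewrite !linear0r.
move=> a x y dx dy; apply: Smax => u du.
by rewrite !linearDr /= !linearZr_LR /= !TS.
Qed.

Lemma selfadjoint_symmetric T : selfadjoint dot T ->
  forall x y, dom T x -> dom T y -> dot (T x) y = dot x (T y).
Proof.
move=> [dTE TE] x y dx dy; rewrite (TE _ dy); apply: adjointP => //.
by rewrite -dTE.
Qed.

End AdjointPairs.

Section Accretive.
Context {R : realType} {X : completeNormedModType R[i]}.
Variable dot : {dot X for Num.conj}.
Hypothesis norm_dot : forall x : X, `|x| ^+ 2 = dot x x.
Implicit Types S T : operator X X.

(** Expand [|T x + l x|^2 = |T x|^2 + 2 l Re <T x, x> + l^2 |x|^2]. *)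
Lemma accretive_shift_lower T (l : R) x : accretive dot T -> 0 <= l -> dom T x ->
  nrm (T x) <= nrm (op_shift T l x) /\ l * nrm x <= nrm (op_shift T l x).
Proof.
move=> accT l0 dx; have Txx : 0 <= l * rdot dot (T x) x.
  by rewrite mulr_ge0 //; exact: accT.
have := nrmD_sqr norm_dot (T x) (l%:C *: x); rewrite rdotZr nrmZr // => eqn.
have lx0 : 0 <= l * nrm x by rewrite mulr_ge0 // nrm_ge0.
split; rewrite -(ler_pXn2r (n := 2)) // ?nnegrE ?nrm_ge0 //= eqn.
  have := sqr_ge0 (l * nrm x); lra.
have := sqr_ge0 (nrm (T x)); lra.
Qed.

(** The extension is [S (x + c z) = T x + c l z]. Orthogonality says that
    [<T x, z> = - l <x, z>], so the cross terms of [Re <S u, u>] cancel and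
    leave [Re <T x, x> + l |c z|^2]. *)
Lemma accretive_extension T (l : R) z :
  linear_op T -> accretive dot T -> 0 < l ->
  (forall x, dom T x -> dot (op_shift T l x) z = 0) -> ~ dom T z ->
  exists S, [/\ linear_op S, accretive dot S, op_ext T S & dom S z].
Proof.
move=> Tl accT l0 zT ndz; have [d0 Tl'] := Tl.
(* [P u p] says that [p] is a decomposition of [u]; it is unique as [z] is not
   in the domain of [T] *)
pose P u (p : X * R[i]) := dom T p.1 /\ u = p.1 + p.2 *: z.
have Puniq u p q : P u p -> P u q -> p = q.
  case: p q => [x c] [x' c'] [/= dx ->] [/= dx' eqn].
  have cc' : c = c'.
    apply/eqP; rewrite -subr_eq0; apply: contrapT => /negP cc'; apply: ndz.
    have -> : z = (c - c')^-1 *: (x' - x).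
      have <- : (c - c') *: z = x' - x.
        apply/eqP; rewrite scalerBl subr_eq addrAC eq_sym subr_eq -eqn.
        by rewrite addrC.
      by rewrite scalerA mulVf // scale1r.
    by apply: (linear_opZ _ Tl _).1; apply: (linear_opB Tl _ _).1.
  by move: eqn; rewrite cc' => /addIr ->.
pose D := [set u | exists p, P u p].
pose S := Operator D (fun u => let p := xget (0, 0) [set p | P u p] in
                               T p.1 + (p.2 * l%:C) *: z).
have SE u p : P u p -> S u = T p.1 + (p.2 * l%:C) *: z.
  move=> Pup; rewrite /S /=; case: xgetP => [q _ Puq|/(_ p)//].
  by rewrite (Puniq _ _ _ Puq Pup).
exists S; split.
- split; first by exists (0, 0); split => //=; rewrite scale0r addr0.
  move=> a u v [[x c] Pu] [[y e] Pv].
  have [dxy Txy] := Tl' a x y Pu.1 Pv.1.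
  have Puv : P (a *: u + v) (a *: x + y, a * c + e).
    split=> //=; rewrite Pu.2 Pv.2 /= scalerDr scalerDl scalerA.
    by rewrite addrACA.
  split; first by exists (a *: x + y, a * c + e).
  rewrite (SE _ _ Puv) (SE _ _ Pu) (SE _ _ Pv) /= Txy scalerDr scalerA.
  by rewrite mulrDl scalerDl mulrA addrACA.
- move=> u [[x c] Pu]; rewrite -/(rdot dot _ _) (SE _ _ Pu) Pu.2 /=.
  have dx : dom T x := Pu.1.
  have Txz : dot (T x) z = - (l%:C * dot x z).
    by have := zT x dx; rewrite /= linearDl linearZl_LR /= => /eqP; rewrite addr_eq0 => /eqP.
  rewrite rdotDl !rdotDr.
  have -> : rdot dot (T x) (c *: z) = - rdot dot ((c * l%:C) *: z) x.
    rewrite [in RHS]rdotC /rdot !linearZr_LR /= Txz rmorphM /=.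
    rewrite -[RHS]raddfN; congr complex.Re.
    have -> : Num.conj (l%:C) = l%:C :> R[i] by rewrite /Num.conj /= oppr0.
    ring.
  rewrite addrA addrNK.
  apply: addr_ge0; first exact: accT.
  rewrite mulrC -scalerA rdotZl rdotxx //.
  by rewrite mulr_ge0 ?exprn_ge0 ?nrm_ge0 // ltW.
- split=> [x dx|x dx]; have Px : P x (x, 0) by split=> //=; rewrite scale0r addr0.
    by exists (x, 0).
  by rewrite (SE _ _ Px) /= mul0r scale0r addr0.
- by exists (0, 1); split => //=; rewrite add0r scale1r.
Qed.

(** Let [z] be orthogonal to the range. By maximality the extension above puts
    [z] in the domain of [T], and then [0 = Re <(T + l) z, z> >= l |z|^2]. *)
Lemma maximal_accretive_shift_surjective T (l : R) :
  linear_op T -> closed_op T -> maximal_accretive dot T -> 0 < l ->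
  forall y, exists2 x, dom T x & op_shift T l x = y.
Proof.
move=> Tl clT [accT maxT] l0.
have l0' := ltW l0.
apply: (surjective_of_orthogonal norm_dot (T := op_shift T l) (c := l)) => //.
- exact: linear_op_shift.
- exact: closed_op_shift.
- by move=> x dx; exact: (accretive_shift_lower accT l0' dx).2.
move=> z zT.
have dz : dom T z.
  apply: contrapT => ndz.
  have [S [Sl accS TS Sz]] := accretive_extension Tl accT l0 zT ndz.
  by have [dS _] := maxT S Sl accS TS; apply: ndz; rewrite -dS.
have := zT z dz; move/(congr1 (@complex.Re R)).
rewrite -/(rdot dot _ _) /= rdotDl rdotZl (rdotxx norm_dot) => eqn.
have := accT z dz; rewrite -/(rdot dot _ _) => Tzz.
apply/nrm_eq0/eqP; rewrite -sqrf_eq0 eq_le sqr_ge0 andbT -(pmulr_rle0 _ l0).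
by move: eqn Tzz => /= ; lra.
Qed.

(** Taking adjoints in [l |x| <= |(T + l) x|] gives [l |y| <= |(S + l) y|], that
    is [0 <= |S y|^2 + 2 l Re <S y, y>] for every [l > 0]; let [l] grow. *)
Lemma adjoint_accretive T S :
  linear_op T -> closed_op T -> maximal_accretive dot T ->
  adjoint_pair dot T S -> accretive dot S.
Proof.
move=> Tl clT maxT [TS _] y dy; rewrite -/(rdot dot _ _).
have key (l : R) : 0 < l -> 0 <= nrm (S y) ^+ 2 + 2 * l * rdot dot (S y) y.
  move=> l0; have [x dx xy] := maximal_accretive_shift_surjective Tl clT maxT l0 y.
  have lx := (accretive_shift_lower maxT.1 (ltW l0) dx).2.
  have yle : l * nrm y <= nrm (op_shift S l y).
    have yy : nrm y ^+ 2 = rdot dot x (op_shift S l y).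
      rewrite -(rdotxx norm_dot) -{1}xy /= rdotDl rdotDr rdotZl rdotZr.
      by rewrite /rdot TS.
    have := rdot_le norm_dot x (op_shift S l y); rewrite -yy => yx.
    have := nrm_ge0 y; rewrite le_eqVlt => /orP[/eqP <-|y0].
      by rewrite mulr0 nrm_ge0.
    rewrite -(ler_pM2r y0) -mulrA -expr2 [leRHS]mulrC.
    apply: (@le_trans _ _ (l * (nrm x * nrm (op_shift S l y)))).
      by rewrite ler_pM2l.
    by rewrite mulrA ler_wpM2r ?nrm_ge0 // -xy.
  have := yle; rewrite -(ler_pXn2r (n := 2)) // ?nnegrE ?nrm_ge0 //.
    rewrite /= (nrmD_sqr norm_dot) rdotZr (nrmZr _ (ltW l0)); lra.
  by rewrite mulr_ge0 ?nrm_ge0 // ltW.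
rewrite leNgt; apply/negP => neg.
(* this value of [l] violates the inequality if [Re <S y, y> < 0] *)
have l0 : 0 < (nrm (S y) ^+ 2 + 1) / - rdot dot (S y) y.
  by rewrite divr_gt0 ?oppr_gt0 // ltr_wpDl // exprn_ge0 // nrm_ge0.
have := key _ l0.
have -> : 2 * ((nrm (S y) ^+ 2 + 1) / - rdot dot (S y) y) * rdot dot (S y) y
   = - 2 * (nrm (S y) ^+ 2 + 1).
  by field; rewrite lt_eqF.
have := sqr_ge0 (nrm (S y)); lra.
Qed.

(** [w] with [<(T + l)^-1 u, v> = <u, w>] for all [u] solves [(S + l) w = v]:
    take [u = (T + l) x]. *)
Lemma adjoint_shift_surjective T S (l : R) :
  linear_op T -> closed_op T -> maximal_accretive dot T ->
  adjoint_pair dot T S -> 0 < l ->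
  forall v, exists2 y, dom S y & op_shift S l y = v.
Proof.
move=> Tl clT maxT [_ Smax] l0 v.
have lower x dx := (@accretive_shift_lower T l x maxT.1 (ltW l0) dx).2.
have [G [GP GK Gl Gle]] := bounded_inverse (linear_op_shift l Tl) l0 lower
  (maximal_accretive_shift_surjective Tl clT maxT l0).
have [||u|w wP] := riesz norm_dot (phi := fun u => dot (G u) v) (c := nrm v / l).
- by move=> a x y; rewrite Gl linearDl linearZl_LR.
- by rewrite divr_ge0 ?nrm_ge0 // ltW.
- rewrite -/(rdot dot _ _); apply: le_trans (rdot_le norm_dot _ _) _.
  rewrite mulrC -mulrA ler_wpM2l ?nrm_ge0 // mulrC.
  by rewrite ler_pdivlMr // mulrC.
have [|dw Sw] := Smax w (v - l%:C *: w).
  move=> x dx; have := wP (op_shift T l x); rewrite GK //=.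
  rewrite linearBr linearDl /= linearZl_LR linearZr_LR /= => ->.
  have -> : Num.conj (l%:C) = l%:C :> R[i] by rewrite /Num.conj /= oppr0.
  by rewrite addrK.
by exists w => //=; rewrite Sw subrK.
Qed.

End Accretive.

(** * The block system *)

Section RelativeBounds.
Context {R : realType} {X : completeNormedModType R[i]}.
Implicit Types S T : operator X X.

Lemma rel_bound_with_nrm S T (a b : R) x :
  rel_bound_with S T a b -> dom T x -> nrm (S x) <= a * nrm (T x) + b * nrm x.
Proof.
by move=> [_ _ ST] dx; have := ST x dx; rewrite !nrmE -!rmorphM -rmorphD lecR.
Qed.

Lemma rel_bound_with_oppr S T (a b : R) :
  rel_bound_with S T a b -> rel_bound_with S (op_opp T) a b.
Proof. by move=> [a0 b0 ST]; split=> // x dx; rewrite /= normrN; exact: ST. Qed.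

Lemma rel_bound_lt S T (r : R) :
  rel_bounded S T -> rel_bound S T < r ->
  exists a b, rel_bound_with S T a b /\ a < r.
Proof.
move=> [_ [a [b STab]]] /inf_lt [|a' [b' ST'] a'r]; last by exists a', b'.
by exists a; exists b.
Qed.

(** The infimum [rel_bound] need not be attained, so the second constant may have
    to exceed 1; it can be taken below [2 / (1 + a)], which is greater than 1. *)
Lemma rel_bounds_product_lt1 S1 T1 S2 T2 :
  rel_bounded S1 T1 -> rel_bound S1 T1 < 1 ->
  rel_bounded S2 T2 -> rel_bound S2 T2 <= 1 ->
  exists a1 b1 a2 b2,
    [/\ rel_bound_with S1 T1 a1 b1, rel_bound_with S2 T2 a2 b2 & a1 * a2 < 1].
Proof.
move=> ST1 lt1 ST2 le1; have [a [b [STab a1]]] := rel_bound_lt ST1 lt1.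
have a0 : 0 <= a by case: STab.
have r1 : 1 < 2 / (1 + a) by rewrite ltr_pdivlMr; lra.
have [a' [b' [STab' a'r]]] := rel_bound_lt ST2 (le_lt_trans le1 r1).
exists a, b, a', b'; split=> //.
have a'2 : a' * (1 + a) < 2 by rewrite -ltr_pdivlMr //; lra.
have a'0 : 0 <= a' by case: STab'.
move: a0 a'0 a1 a'2 => {STab STab' a'r r1 lt1 le1}; nra.
Qed.

End RelativeBounds.

Lemma small_shifted_bounds (R : realType) (a b a' b' : R) :
  0 <= a -> 0 <= b -> 0 <= a' -> 0 <= b' -> a * a' < 1 ->
  exists2 l, 0 < l & (a + b / l) * (a' + b' / l) < 1.
Proof.
move=> a0 b0 a'0 b'0 aa'.
set K := a * b' + a' * b + b * b'.
have K0 : 0 <= K by rewrite /K !addr_ge0 ?mulr_ge0.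
have d0 : 0 < 1 - a * a' by lra.
pose l := 1 + K / (1 - a * a').
have l1 : 1 <= l by rewrite lerDl divr_ge0 // ltW.
have l0 : 0 < l by lra.
exists l => //; set i := l^-1.
(* with [i = l^-1], the product is [a a' + i (a b' + a' b) + i^2 b b'], at most
   [a a' + i K] *)
have i0 : 0 < i by rewrite invr_gt0.
have i1 : i <= 1 by rewrite invf_le1.
have iK : i * K < 1 - a * a'.
  rewrite mulrC ltr_pdivrMr // mulrDr mulr1 mulrCA divff ?gt_eqF // mulr1.
  lra.
have ibb : i * i * (b * b') <= i * (b * b').
  by rewrite ler_wpM2r ?mulr_ge0 // ler_piMl // ltW.
have -> : (a + b * i) * (a' + b' * i)
    = a * a' + i * K + (i * i * (b * b') - i * (b * b')) by rewrite /K; ring.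
lra.
Qed.

Section BlockSystem.
Context {R : realType} {X : completeNormedModType R[i]}.
Variable dot : {dot X for Num.conj}.
Hypothesis norm_dot : forall x : X, `|x| ^+ 2 = dot x x.
Implicit Types S T B C : operator X X.

Lemma rel_bound_shift C T (a b l : R) x :
  accretive dot T -> rel_bound_with C T a b -> 0 < l -> dom T x ->
  nrm (C x) <= (a + b / l) * nrm (op_shift T l x).
Proof.
move=> accT CT l0 dx; have [a0 b0 _] := CT.
have [Tle xle] := accretive_shift_lower norm_dot accT (ltW l0) dx.
apply: le_trans (rel_bound_with_nrm CT dx) _; rewrite mulrDl lerD //.
  by rewrite ler_wpM2l.
by rewrite -mulrA ler_wpM2l // ler_pdivlMl.
Qed.

(** With [v = (S + l) y], the second equation gives
    [x = (T + l)^-1 (g + B (S + l)^-1 v)]; the first becomes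
    [v + C (T + l)^-1 B (S + l)^-1 v = f - C (T + l)^-1 g]. *)
Lemma shifted_system_solvable T S C B (a b a' b' : R) :
  linear_op T -> closed_op T -> maximal_accretive dot T ->
  adjoint_pair dot T S ->
  linear_op C -> dom T `<=` dom C -> rel_bound_with C T a b ->
  linear_op B -> dom S `<=` dom B -> rel_bound_with B S a' b' ->
  a * a' < 1 ->
  exists2 l, 0 < l & forall f g, exists x y,
    [/\ dom T x, dom S y, C x + op_shift S l y = f & op_shift T l x - B y = g].
Proof.
move=> Tl clT maxT TS Cl TC CT Bl SB BS aa'.
have Sl := adjoint_pair_linear TS.
have accS := adjoint_accretive norm_dot Tl clT maxT TS.
have [a0 b0 _] := CT; have [a'0 b'0 _] := BS.
have [l l0 small] := small_shifted_bounds a0 b0 a'0 b'0 aa'.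
exists l => // f g.
have Tlow x dx := (@accretive_shift_lower _ _ _ norm_dot T l x maxT.1 (ltW l0) dx).2.
have Slow x dx := (@accretive_shift_lower _ _ _ norm_dot S l x accS (ltW l0) dx).2.
have [G [GP _ Gl _]] := bounded_inverse (linear_op_shift l Tl) l0 Tlow
  (maximal_accretive_shift_surjective norm_dot Tl clT maxT l0).
have [H [HP _ Hl _]] := bounded_inverse (linear_op_shift l Sl) l0 Slow
  (adjoint_shift_surjective norm_dot Tl clT maxT TS l0).
have CGl (c : R[i]) x y : C (G (c *: x + y)) = c *: C (G x) + C (G y).
  by rewrite Gl; apply: (Cl.2 c _ _ _ _).2; apply: TC; apply: (GP _).1.
have BHl (c : R[i]) x y : B (H (c *: x + y)) = c *: B (H x) + B (H y).
  by rewrite Hl; apply: (Bl.2 c _ _ _ _).2; apply: SB; apply: (HP _).1.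
have CGle x : nrm (C (G x)) <= (a + b / l) * nrm x.
  have [dG GT] := GP x; rewrite -{2}GT; exact: rel_bound_shift maxT.1 CT l0 dG.
have BHle x : nrm (B (H x)) <= (a' + b' / l) * nrm x.
  have [dH HS] := HP x; rewrite -{2}HS; exact: rel_bound_shift accS BS l0 dH.
have p0 : 0 <= a + b / l by rewrite addr_ge0 // divr_ge0 // ltW.
have q0 : 0 <= a' + b' / l by rewrite addr_ge0 // divr_ge0 // ltW.
pose K v := C (G (B (H v))).
have [||v|v vP] := id_plus_contraction_surjective norm_dot (K := K)
    (k := (a + b / l) * (a' + b' / l)) _ _ _ (f - C (G g)).
- by move=> c x y; rewrite /K BHl CGl.
- by rewrite mulr_ge0.
- by apply: le_trans (CGle _) _; rewrite -mulrA ler_wpM2l.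
have [dH HS] := HP v; have [dG GT] := GP (g + B (H v)).
exists (G (g + B (H v))), (H v); split=> //; last by rewrite GT addrK.
rewrite HS; have := CGl 1 g (B (H v)); rewrite !scale1r => ->.
by rewrite -addrA [C (G (B (H v))) + v]addrC vP addrC subrK.
Qed.

(** If [z] is in the domain of the adjoint, with [W^* z = w], solve
    [(W + N) u = w + N z] in the domain of [W]. Then [z - u] is orthogonal to the
    range of [W + N], which is everything, so [z = u]. *)
Lemma selfadjoint_of_surjective (W : operator (X * X)%type (X * X)%type)
    (N : X * X -> X * X) :
  (forall u v, dom W u -> dom W v -> dot_prod dot (W u) v = dot_prod dot u (W v)) ->
  (forall u v, dot_prod dot (N u) v = dot_prod dot u (N v)) ->
  (forall w, exists2 u, dom W u & W u + N u = w) ->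
  selfadjoint (dot_prod dot) W.
Proof.
move=> Wsym Nsym Wonto.
have dpDl u v w : dot_prod dot (u + v) w = dot_prod dot u w + dot_prod dot v w.
  by rewrite /dot_prod !linearDl /= addrACA.
have dpDr u v w : dot_prod dot u (v + w) = dot_prod dot u v + dot_prod dot u w.
  by rewrite /dot_prod !linearDr /= addrACA.
have dpBr u v w : dot_prod dot u (v - w) = dot_prod dot u v - dot_prod dot u w.
  by rewrite /dot_prod !linearBr /= opprD addrACA.
have dp0 u : dot_prod dot u u = 0 -> u = 0.
  case: u => u v; rewrite /dot_prod !(dotxx norm_dot) -rmorphD /=.
  move=> [/eqP]; rewrite paddr_eq0 ?exprn_ge0 ?nrm_ge0 // !sqrf_eq0.
  by move=> /andP[/eqP/nrm_eq0 -> /eqP/nrm_eq0 ->].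
have Wmax z w : (forall u, dom W u -> dot_prod dot (W u) z = dot_prod dot u w) ->
    dom W z /\ W z = w.
  move=> zw; have [u du uP] := Wonto (w + N z).
  have zu : z = u.
    apply/eqP; rewrite -subr_eq0; apply/eqP/dp0.
    have [v dv vP] := Wonto (z - u); rewrite -{1}vP dpBr !dpDl.
    rewrite zw // !Nsym -dpDr -uP Wsym // dpDr.
    by rewrite subrr.
  by rewrite zu; split=> //; move: uP; rewrite zu => /addIr.
split.
  apply/seteqP; split=> [z dz|z [w zw]].
    by exists (W z) => u du; exact: Wsym.
  by have [] := Wmax z w zw.
move=> z dz; apply: (Wmax _ _ _).2 => u du.
have zz : exists w, forall u, dom W u -> dot_prod dot (W u) z = dot_prod dot u w.
  by exists (W z) => v dv; exact: Wsym.
exact: (xgetPex 0 zz).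
Qed.

End BlockSystem.

Theorem corollary3p2 (R : realType) (X : completeNormedModType R[i])
    (dot : {dot X for Num.conj})
    (norm_dot : forall x : X, `|x| ^+ 2 = dot x x)
    (A B C : operator X X)
    (ham : is_hamiltonian dot A B C)
    (dom_ham : dom (hamiltonian_op dot A B C) = dom A `*` dom (adjoint dot A))
    (accr : maximal_accretive dot A \/ maximal_accretive dot (op_opp A))
    (bounds :
      [/\ rel_bounded C A, rel_bound C A < 1,
          rel_bounded B (adjoint dot A) & rel_bound B (adjoint dot A) <= 1]
      \/
      [/\ rel_bounded C A, rel_bound C A <= 1,
          rel_bounded B (adjoint dot A) & rel_bound B (adjoint dot A) < 1]) :
  selfadjoint (dot_prod dot) (op_comp op_J (hamiltonian_op dot A B C)).
Proof.
have [[Al clA dA] [Bl _ _] [Cl _ _] [Bsa Csa] _] := ham.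
set As := adjoint dot A.
have pairA : adjoint_pair dot A As by exact: adjoint_pair_adjoint.
have Asl := adjoint_pair_linear pairA.
have [a [b [a' [b' [CA BAs aa']]]]] : exists a b a' b',
    [/\ rel_bound_with C A a b, rel_bound_with B As a' b' & a * a' < 1].
  case: bounds => -[CA CA1 BA BA1]; first exact: rel_bounds_product_lt1.
  have [a' [b' [a [b [? ? ?]]]]] := rel_bounds_product_lt1 BA BA1 CA CA1.
  by exists a, b, a', b'; rewrite mulrC.
have [AC AsB] : dom A `<=` dom C /\ dom As `<=` dom B.
  by case: bounds => -[[? _] _ [? _] _].
set W := op_comp _ _.
have WE x y : W (x, y) = (C x - As y, - A x - B y).
  by rewrite /W /= add0r addr0 opprD.
have domW x y : dom W (x, y) <-> dom A x /\ dom As y.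
  have -> : dom W (x, y) = dom (hamiltonian_op dot A B C) (x, y).
    by apply/propext; split=> [[]|] //.
  by rewrite dom_ham.
have Wsym u v : dom W u -> dom W v -> dot_prod dot (W u) v = dot_prod dot u (W v).
  case: u v => [x y] [x' y'] /domW[dx dy] /domW[dx' dy'].
  rewrite !WE /dot_prod /= !linearBl !linearBr /= !linearNl !linearNr /=.
  rewrite (selfadjoint_symmetric Csa); [|exact: AC|exact: AC].
  rewrite (selfadjoint_symmetric Bsa); [|exact: AsB|exact: AsB].
  rewrite (pairA.1 _ _ dx dy') -/As.
  have -> : dot (As y) x' = dot y (A x') by rewrite dotC -(pairA.1 _ _ dx' dy) -dotC.
  ring.
pose N (t : R) (u : X * X) := (t%:C *: u.2, t%:C *: u.1).
have Nsym t u v : dot_prod dot (N t u) v = dot_prod dot u (N t v).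
  rewrite /dot_prod /= !linearZl_LR !linearZr_LR /=.
  have -> : Num.conj (t%:C) = t%:C :> R[i] by rewrite /Num.conj /= oppr0.
  by rewrite addrC.
suff [t Wonto] : exists t, forall w, exists2 u, dom W u & W u + N t u = w.
  exact: (selfadjoint_of_surjective norm_dot Wsym (Nsym t) Wonto).
case: accr => maxA.
  have [l _ sol] := shifted_system_solvable norm_dot Al clA maxA pairA
    Cl AC CA Bl AsB BAs aa'.
  (* here [T = A], and the system is solved for [- y] in place of [y] *)
  exists (- l) => -[f g]; have [x [y [dx dy <- gE]]] := sol f (- g).
  have [dNy AsNy] := linear_opN Asl dy.
  exists (x, - y); first exact/domW.
  rewrite WE AsNy (linear_opN Bl (AsB _ dy)).2 /N /=; congr (_, _).
    by rewrite opprK rmorphN /= scaleNr scalerN opprK addrA.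
  rewrite -[g]opprK -gE /= opprK rmorphN /= scaleNr opprD opprK.
  by rewrite opprD addrAC.
have [l _ sol] := shifted_system_solvable norm_dot (linear_op_opp Al)
  (closed_op_opp clA) maxA (adjoint_pair_opp pairA)
  Cl AC (rel_bound_with_oppr CA) Bl AsB (rel_bound_with_oppr BAs) aa'.
(* here [T = - A] and [S = - A^*], and the signs match *)
exists l => -[f g]; have [x [y [dx dy <- <-]]] := sol f g.
exists (x, y); first exact/domW.
rewrite WE /N /=; congr (_, _); first by rewrite addrA.
by rewrite addrAC.
Qed.
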